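(* If $g\in GL(2,\mathcal{O}_{-3})$ is of finite order $r$ and $\det(g)=e^{-\frac{2\pi i}{3}}$, then $$\mathrm{tr}(g)\in\left\{0,\pm\tfrac{1-\sqrt{-3}}{2},\pm(1-\sqrt{-3})\right\},\qquad r\in\{3,6,12\}.$$ More precisely, for the eigenvalues $\lambda_1,\lambda_2$ of $g$ (up to a transposition): (i) $\mathrm{tr}(g)=0$ or, equivalently, $\lambda_1=e^{\frac{\pi i}{6}}$, $\lambda_2=e^{-\frac{5\pi i}{6}}$, if and only if $g$ is of order $12$; (ii) if $\mathrm{tr}(g)=\frac{1-\sqrt3i}{2}$ or, equivalently, $\lambda_1=e^{\frac{4\pi i}{3}}$, $\lambda_2=1$, then $g$ is of order $3$; (iii) if $\mathrm{tr}(g)=-1+\sqrt3i$ or, equivalently, $g=e^{\frac{2\pi i}{3}}I_2$, then $g$ is of order $3$; (iv) if $\mathrm{tr}(g)=\frac{-1+\sqrt3i}{2}$ or, equivalently, $\lambda_1=e^{\frac{\pi i}{3}}$, $\lambda_2=-1$, then $g$ is of order $6$; (v) if $\mathrm{tr}(g)=1-\sqrt3i$ or, equivalently, $g=e^{-\frac{\pi i}{3}}I_2$, then $g$ is of order $6$.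
   Context: $\mathcal{O}_{-3}=\mathbb{Z}+\frac{1+\sqrt{-3}}{2}\mathbb{Z}$ is the ring of the Eisenstein integers, $\sqrt{-3}=i\sqrt3$, and $GL(2,\mathcal{O}_{-3})$ is the group of $2\times2$ matrices over $\mathcal{O}_{-3}$ with determinant in $\mathcal{O}_{-3}^*=\langle e^{\frac{\pi i}{3}}\rangle$. *)

(* Defs.v *)
From mathcomp Require Export all_boot all_order all_algebra.
From mathcomp Require Export complex.
From mathcomp Require Export reals trigo.

Set Implicit Arguments.
Unset Strict Implicit.
Unset Printing Implicit Defensive.

Import GRing.Theory Num.Theory.
Local Open Scope ring_scope.
Local Open Scope complex_scope.

(* The complex numbers are [R[i]], with [R] a model of the real numbers. *)

Definition expi (R : realType) (t : R) : R[i] := cos t +i* sin t.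

Definition sqrtm3 (R : realType) : R[i] := 0 +i* Num.sqrt 3.

Definition eisenstein (R : realType) (z : R[i]) : Prop :=
  exists a b : int, z = a%:~R + b%:~R * ((1 + sqrtm3 R) / 2).

Definition eisenstein_unit (R : realType) (z : R[i]) : Prop :=
  eisenstein z /\ exists2 w : R[i], eisenstein w & z * w = 1.

Definition GL2_eisenstein (R : realType) (g : 'M[R[i]]_2) : Prop :=
  (forall i j, eisenstein (g i j)) /\ eisenstein_unit (\det g).

Definition has_order (R : realType) (g : 'M[R[i]]_2) (r : nat) : Prop :=
  [/\ (0 < r)%N, g ^+ r = 1 & forall k, (0 < k < r)%N -> g ^+ k <> 1].

(* The eigenvalues of [g] are l1 and l2, with algebraic multiplicity; the order
   of the pair is irrelevant. *)
Definition eigenvalues (R : realType) (g : 'M[R[i]]_2) (l1 l2 : R[i]) : Prop :=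
  char_poly g = ('X - l1%:P) * ('X - l2%:P).

(* Main.v *)
Require Import Defs.
From mathcomp Require Import all_boot all_order all_algebra.
From mathcomp Require Import complex reals trigo.
From mathcomp Require Import ring lra zify.

(** Let w be the primitive sixth root of unity e^(i pi/3), so that
    w^2 = w - 1; with 1 it generates the Eisenstein integers over Z, and the hypothesis
    on the determinant reads det g = - w.

    The trace.  Finite order puts both eigenvalues on the unit circle, so
    |tr g| <= 2 and det g * conj (tr g) = tr g
    ([norm_mxtrace_finite_order], [conj_mxtrace_finite_order]).  With
    det g = - w the second relation confines tr g to the real line through
    1 - w = conj w, on which the only Eisenstein integers are the integer
    multiples s (1 - w); as |1 - w| = 1, the first relation leaves -2 <= s <= 2
    ([mxtrace_sixth_root_multiple]).  These are the five listed traces.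

    The eigenvalues.  A 2 x 2 characteristic polynomial is determined by trace
    and determinant, so prescribing eigenvalues with product - w amounts to
    prescribing their sum ([char_poly2_splitE]).

    The scalar cases.  If s = 2 or s = -2 then w g, respectively - w g, has
    determinant 1, trace 2 and finite order; by Cayley-Hamilton it is
    unipotent, hence the identity ([SL2_finite_order_trace2]), and g is scalar.

    The order.  Since - w has order 3, so has det g, and 3 divides r
    ([order_dvd3]).  Cayley-Hamilton gives g^3 = s if s = 1 or s = -1
    ([sixth_root_mx_cube]) and g^2 = w, hence g^6 = -1, if s = 0; in the scalar
    cases s = 2 and s = -2 the cube is -1 and 1.  Together with 3 | r this
    forces r = 3 when g^3 = 1, r = 6 when g^3 = -1 and r = 12 when g^6 = -1. *)

Set Implicit Arguments.
Unset Strict Implicit.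
Unset Printing Implicit Defensive.

Import GRing.Theory Num.Theory.
Local Open Scope ring_scope.
Local Open Scope complex_scope.

(** * Two by two matrices *)

Lemma char_poly2 (F : comNzRingType) (g : 'M[F]_2) :
  char_poly g = 'X^2 - \tr g *: 'X + (\det g)%:P.
Proof.
apply/polyP => -[|[|[|i]]].
- rewrite -/((char_poly g)`_0) char_poly_det sqrrN expr1n mul1r.
  by rewrite !coefD coefN coefZ coefXn coefX coefC /=; ring.
- rewrite (char_poly_trace (n := 2) g) //.
  by rewrite !coefD coefN coefZ coefXn coefX coefC /=; ring.
- have /monicP := char_poly_monic g; rewrite /lead_coef size_char_poly /= => ->.
  by rewrite !coefD coefN coefZ coefXn coefX coefC /=; ring.
- rewrite nth_default ?size_char_poly //.
  by rewrite !coefD coefN coefZ coefXn coefX coefC /=; ring.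
Qed.

(** Both sides are monic of degree 2 with the same constant term, so only the
    coefficients of 'X, i.e. minus the traces, remain to be compared. *)
Lemma char_poly2_splitE (F : comNzRingType) (g : 'M[F]_2) (a b : F) :
  \det g = a * b ->
  \tr g = a + b <-> char_poly g = ('X - a%:P) * ('X - b%:P).
Proof.
move=> dg; rewrite char_poly2 dg; split => [->|/polyP/(_ 1%N)].
  by rewrite -mul_polyC polyCD polyCM; ring.
have -> : ('X - a%:P) * ('X - b%:P) = 'X^2 - (a + b) *: 'X + (a * b)%:P.
  by rewrite -mul_polyC polyCD polyCM; ring.
rewrite !coefD !coefN !coefZ coefXn coefX coefC /= !mulr1 !addr0 !add0r.
exact: oppr_inj.
Qed.

Lemma mx2_sqr (F : comNzRingType) (g : 'M[F]_2) :
  g ^+ 2 = \tr g *: g - (\det g)%:M.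
Proof.
have := Cayley_Hamilton g; rewrite char_poly2 rmorphD rmorphB /= linearZ /=.
rewrite horner_mx_C rmorphXn /= horner_mx_X => /eqP.
rewrite addr_eq0 => /eqP e; apply/eqP.
by rewrite -subr_eq0 opprB addrCA e subrr.
Qed.

(** * Matrices of finite order *)

Lemma root_char_poly_finite_order (F : fieldType) n (g : 'M[F]_n.+1) k a :
  g ^+ k = 1 -> root (char_poly g) a -> a ^+ k = 1.
Proof.
move=> gk; rewrite -eigenvalue_root_char => /eigenvalueP[v vg v0].
have vgk j : v *m g ^+ j = a ^+ j *: v.
  elim: j => [|j IH]; first by rewrite !expr0 mulmx1 scale1r.
  by rewrite exprS -mulmxE mulmxA vg -scalemxAl IH scalerA exprS.
have := vgk k; rewrite gk mulmx1 => /eqP.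
rewrite -{1}[v]scale1r -subr_eq0 -scalerBl scaler_eq0 (negPf v0) orbF subr_eq0.
by move/eqP.
Qed.

Lemma eigenvalues_finite_order (C : numClosedFieldType) (g : 'M[C]_2) k :
  (0 < k)%N -> g ^+ k = 1 ->
  exists a b : C,
    [/\ `|a| = 1, `|b| = 1, \tr g = a + b & \det g = a * b].
Proof.
move=> k0 gk.
have normE a : a ^+ k = 1 -> `|a| = 1.
  move=> ak; apply/eqP; rewrite -(pexpr_eq1 k0) ?normr_ge0 //.
  by rewrite -normrX ak normr1.
(* The second root is defined by the trace; rootedness of a gives the product. *)
have [a ea] := @eigenvalue_closed C 2 g isT.
rewrite eigenvalue_root_char in ea.
have trE : \tr g = a + (\tr g - a) by ring.
have detE : \det g = a * (\tr g - a).
  move/rootP: ea; rewrite char_poly2 !hornerE => /eqP.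
  by rewrite addrC addr_eq0 => /eqP ->; ring.
exists a, (\tr g - a); split => //; apply: normE;
  apply: (root_char_poly_finite_order gk) => //.
have /(char_poly2_splitE detE) -> := trE.
by rewrite rootM !root_XsubC eqxx orbT.
Qed.

Lemma norm_mxtrace_finite_order (C : numClosedFieldType) (g : 'M[C]_2) k :
  (0 < k)%N -> g ^+ k = 1 -> `|\tr g| <= 2.
Proof.
move=> k0 gk; have [a [b [na nb -> _]]] := eigenvalues_finite_order k0 gk.
by have := ler_normD a b; rewrite na nb.
Qed.

(** On the unit circle conjugation is inversion, and
    a b (1/a + 1/b) = a + b. *)
Lemma conj_mxtrace_finite_order (C : numClosedFieldType) (g : 'M[C]_2) k :
  (0 < k)%N -> g ^+ k = 1 -> \det g * (\tr g)^* = \tr g.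
Proof.
move=> k0 gk; have [a [b [na nb -> ->]]] := eigenvalues_finite_order k0 gk.
have conjE (x : C) : `|x| = 1 -> x * x^* = 1.
  by move=> nx; rewrite -normCK nx expr1n.
by rewrite rmorphD /= mulrDr addrC -!mulrA conjE // mulr1 mulrCA conjE // mulr1.
Qed.

(** With n = u - 1 of square zero, u^k = 1 + k n, which is 1 only if n = 0 since
    the characteristic is zero. *)
Lemma unipotent_finite_order (F : numFieldType) (A : algType F) (u : A) k :
  (u - 1) ^+ 2 = 0 -> (0 < k)%N -> u ^+ k = 1 -> u = 1.
Proof.
move=> u2 k0 uk.
have uE j : u ^+ j = 1 + (u - 1) *+ j.
  elim: j => [|j IH]; first by rewrite mulr0n addr0.
  rewrite exprSr IH -{2}[u](subrK 1) mulrDr mulr1 mulrDl mul1r.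
  by rewrite mulrnAl -expr2 u2 mul0rn addr0 mulrS addrCA.
move: uk; rewrite uE -[RHS]addr0 => /addrI/eqP.
by rewrite -scaler_nat scaler_eq0 pnatr_eq0 eqn0Ngt k0 /= subr_eq0 => /eqP.
Qed.

(** Cayley-Hamilton reads (h - 1)^2 = 0. *)
Lemma SL2_finite_order_trace2 (F : numFieldType) (h : 'M[F]_2) k :
  \det h = 1 -> \tr h = 2 -> (0 < k)%N -> h ^+ k = 1 -> h = 1.
Proof.
move=> dh th; apply: unipotent_finite_order.
rewrite sqrrB1 mx2_sqr dh th scaler_nat -[1%:M]/(1 : 'M[F]_2).
by rewrite addrAC subrK subrr.
Qed.

Lemma det_exp (F : comNzRingType) n (g : 'M[F]_n.+1) k :
  \det (g ^+ k) = \det g ^+ k.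
Proof.
elim: k => [|k IH]; first by rewrite !expr0 det1.
by rewrite !exprS -mulmxE det_mulmx IH.
Qed.

Lemma expr_order_dvd (T : pzSemiRingType) (x : T) r n :
  (0 < r)%N -> x ^+ r = 1 -> (forall k, (0 < k < r)%N -> x ^+ k <> 1) ->
  x ^+ n = 1 -> (r %| n)%N.
Proof.
move=> r0 xr rmin xn; rewrite /dvdn; case: posnP => // m0.
case: (rmin (n %% r)%N); first by rewrite m0 ltn_pmod.
by move: xn; rewrite {1}(divn_eq n r) exprD mulnC exprM xr expr1n mul1r.
Qed.

(** * Primitive sixth roots of unity *)

Lemma sixth_root_cube (F : comNzRingType) (w : F) :
  w ^+ 2 = w - 1 -> w ^+ 3 = -1.
Proof. by move=> w2; rewrite exprS w2 mulrBr -expr2 w2 mulr1; ring. Qed.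

Lemma sixth_root_conj_cube (F : comNzRingType) (w : F) :
  w ^+ 2 = w - 1 -> (1 - w) ^+ 3 = -1.
Proof.
move=> w2.
have -> : (1 - w) ^+ 3 = 1 - 3 * w + 3 * w ^+ 2 - w ^+ 3 by ring.
by rewrite sixth_root_cube // w2; ring.
Qed.

Lemma sixth_root_inv (F : comNzRingType) (w : F) :
  w ^+ 2 = w - 1 -> w * (1 - w) = 1.
Proof. by move=> w2; rewrite mulrBr mulr1 -expr2 w2; ring. Qed.

(** These two values are what - w = 1 and (- w)^2 = 1 would force on w; they are
    excluded because (w + 1) (2 - w) = 3. *)
Lemma sixth_root_neq (F : numFieldType) (w : F) :
  w ^+ 2 = w - 1 -> (w != -1) && (w != 2).
Proof.
move=> w2.
have wE : (w + 1) * (2 - w) = 3.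
  have -> : (w + 1) * (2 - w) = 2 + w - w ^+ 2 by ring.
  by rewrite w2; ring.
rewrite -addr_eq0 -[w == 2]subr_eq0 -[w - 2]opprB oppr_eq0 -negb_or -mulf_eq0.
by rewrite wE pnatr_eq0.
Qed.

Lemma sixth_root_norm (C : numClosedFieldType) (w : C) :
  w ^+ 2 = w - 1 -> `|w| = 1.
Proof.
move=> w2; apply/eqP; rewrite -(@pexpr_eq1 _ _ 3) //.
by rewrite -normrX sixth_root_cube // normrN1.
Qed.

Lemma sixth_root_conj (C : numClosedFieldType) (w : C) :
  w ^+ 2 = w - 1 -> (w^*)%R = 1 - w.
Proof.
move=> w2; have ww := sixth_root_inv w2.
have w0 : w != 0.
  by apply/eqP => w0; move/eqP: ww; rewrite w0 mul0r eq_sym oner_eq0.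
by apply: (mulfI w0); rewrite ww -normCK sixth_root_norm // expr1n.
Qed.

(** * Matrices of finite order and determinant - w *)

(** The relation between tr g and its conjugate becomes (a + b) (1 + w) = 0, so
    b = - a and s = a; the bound on s is the bound on |tr g|. *)
Lemma mxtrace_sixth_root_multiple (C : numClosedFieldType) (w : C)
    (g : 'M[C]_2) k (a b : int) :
  w ^+ 2 = w - 1 -> \det g = - w -> (0 < k)%N -> g ^+ k = 1 ->
  \tr g = a%:~R + b%:~R * w ->
  exists2 s : int, \tr g = s%:~R * (1 - w) & s \in [:: -2; -1; 0; 1; 2].
Proof.
move=> w2 detg k0 gk tE.
have trE : \tr g = a%:~R * (1 - w).
  have := conj_mxtrace_finite_order k0 gk.
  rewrite detg tE rmorphD rmorphM /= !rmorph_int sixth_root_conj // => tr_conj.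
  have /eqP : (a%:~R + b%:~R) * (1 + w) = 0.
    have -> : (a%:~R + b%:~R) * (1 + w) =
      a%:~R + b%:~R * w - (- w * (a%:~R + b%:~R * (1 - w)))
        + b%:~R * (w ^+ 2 - (w - 1)) by ring.
    by rewrite tr_conj w2 !subrr mulr0 addr0.
  rewrite mulf_eq0 => /orP[/eqP ab|/eqP w1].
    have -> : b%:~R = - a%:~R :> C by apply/eqP; rewrite -addr_eq0 addrC ab.
    by ring.
  case/andP: (sixth_root_neq w2) => /eqP[].
  by rewrite -[w](addrK 1) [w + 1]addrC w1 sub0r.
exists a => //; have := norm_mxtrace_finite_order k0 gk.
rewrite trE normrM -(sixth_root_conj w2) norm_conjC sixth_root_norm //.
by rewrite mulr1 -intr_norm -[2]/(2%:~R) ler_int !inE; lia.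
Qed.

(** Cayley-Hamilton gives g^2 = (tr g) g + w, and (1 - w)^2 = - w; multiplying by
    g and reducing again yields the formula. *)
Lemma sixth_root_mx_cube (F : comNzRingType) (w : F) (g : 'M[F]_2) (s : int) :
  w ^+ 2 = w - 1 -> \det g = - w -> \tr g = s%:~R * (1 - w) ->
  g ^+ 3 = ((1 - s%:~R ^+ 2) * w) *: g + (s%:~R)%:M.
Proof.
move=> w2 detg tE.
have g2 : g ^+ 2 = \tr g *: g + w%:A.
  by rewrite mx2_sqr detg -[(- w)%:M]scalemx1 scaleNr opprK.
rewrite exprS g2 mulrDr -scalerAr -expr2 g2 mulr_algr scalerDr !scalerA.
rewrite addrAC -scalerDl -[(s%:~R)%:M]scalemx1 tE; congr (_ *: _ + _ *: _).
  have -> : s%:~R * (1 - w) * (s%:~R * (1 - w)) + w =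
            s%:~R ^+ 2 * (1 - 2 * w + w ^+ 2) + w by ring.
  by rewrite w2; ring.
have -> : s%:~R * (1 - w) * w = s%:~R * (w - w ^+ 2) by ring.
by rewrite w2; ring.
Qed.

Lemma order_dvd3 (F : numFieldType) (w : F) (g : 'M[F]_2) n :
  w ^+ 2 = w - 1 -> \det g = - w -> g ^+ n = 1 -> (3 %| n)%N.
Proof.
move=> w2 detg gn; have /andP[wN1 wN2] := sixth_root_neq w2.
apply: (@expr_order_dvd _ (- w)) => //.
- by rewrite exprNn (sixth_root_cube w2) -exprSr -signr_odd.
- case=> [|[|[|]]] // _; rewrite ?expr1 ?sqrrN ?w2 => /eqP wE.
    by case/negP: wN1; rewrite -eqr_oppLR.
  by case/negP: wN2; rewrite -subr_eq.
by rewrite -detg -det_exp gn det1.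
Qed.

(** The matrix s w g has determinant s^2 w^2 (- w) = 1, trace 2 s^2 = 2 and order
    dividing 6 k, so it is the identity. *)
Lemma sixth_root_mx_scalar (F : numFieldType) (w : F) (g : 'M[F]_2)
    (s : int) k :
  w ^+ 2 = w - 1 -> \det g = - w -> (0 < k)%N -> g ^+ k = 1 ->
  s \in [:: 1; -1] -> \tr g = (2 * s)%:~R * (1 - w) ->
  g = (s%:~R * (1 - w))%:M.
Proof.
move=> w2 detg k0 gk s1 tE; have w3 := sixth_root_cube w2.
have ss : s%:~R * s%:~R = 1 :> F.
  by move: s1; rewrite !inE => /orP[]/eqP->; ring.
have ww := sixth_root_inv w2.
have : (s%:~R * w) *: g = 1.
  apply: (@SL2_finite_order_trace2 _ _ (6 * k)).
  - rewrite detZ detg.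
    have -> : (s%:~R * w) ^+ 2 * - w = - (s%:~R * s%:~R) * w ^+ 3 by ring.
    by rewrite ss w3; ring.
  - rewrite mxtraceZ tE intrM.
    have -> : s%:~R * w * (2 * s%:~R * (1 - w)) =
              2 * (s%:~R * s%:~R) * (w * (1 - w)) :> F by ring.
    by rewrite ss ww !mulr1.
  - by rewrite muln_gt0.
  - rewrite exprZn (exprM (s%:~R * w)) [(6 * k)%N]mulnC exprM gk expr1n.
    have -> : (s%:~R * w) ^+ 6 = (s%:~R * s%:~R) ^+ 3 * w ^+ 3 * w ^+ 3.
      by ring.
    by rewrite ss w3 expr1n mul1r mulN1r opprK expr1n scale1r.
move=> hE; have -> : g = (s%:~R * (1 - w)) *: ((s%:~R * w) *: g).
  rewrite scalerA.
  have -> : s%:~R * (1 - w) * (s%:~R * w) = s%:~R * s%:~R * (w * (1 - w)).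
    by ring.
  by rewrite ss ww mul1r scale1r.
by rewrite hE -[RHS]scalemx1.
Qed.

(** * The exponentials e^(it) *)

Lemma expiD (R : realType) (s t : R) : expi (s + t) = expi s * expi t.
Proof.
apply/eqP; rewrite /expi eq_complex /= cosD sinD eqxx addrC /=.
by apply/eqP; ring.
Qed.

Lemma expipi (R : realType) : expi (pi : R) = -1.
Proof. by rewrite /expi cospi sinpi; simpc. Qed.

Lemma sqr_sqrtm3 (R : realType) : sqrtm3 R ^+ 2 = -3.
Proof.
rewrite -(rmorph_nat (real_complex R)) -rmorphN /= /sqrtm3 expr2.
apply/eqP; rewrite eq_complex /= !mul0r mulr0 addr0 eqxx andbT sub0r.
by rewrite -expr2 sqr_sqrtr ?ler0n.
Qed.

(** The cube of e^(i pi/3) is -1; of the three roots of X^3 + 1 only one has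
    positive imaginary part. *)
Lemma expi_pi3 (R : realType) : expi (pi / 3 : R) = (1 + sqrtm3 R) / 2.
Proof.
set z := expi _.
have z3 : z ^+ 3 = -1.
  rewrite -expipi !exprS expr0 mulr1 -!expiD; congr expi; lra.
have im_pos : 0 < complex.Im z.
  by rewrite /z /expi /=; apply: sin_gt0_pi; have := pi_gt0 R; lra.
have : (z + 1) * ((z - (1 + sqrtm3 R) / 2) * (z - (1 - sqrtm3 R) / 2)) = 0.
  have -> : (z + 1) * ((z - (1 + sqrtm3 R) / 2) * (z - (1 - sqrtm3 R) / 2)) =
            (z ^+ 3 + 1) + (z + 1) * (- (sqrtm3 R ^+ 2) - 3) / 4 by field.
  by rewrite z3 sqr_sqrtm3; ring.
move/eqP; rewrite !mulf_eq0 addr_eq0 !subr_eq0 => /or3P[]/eqP // zE.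
  by move: im_pos; rewrite zE /= oppr0 Order.POrderTheory.ltxx.
have /(congr1 (@complex.Im R)) : z + z = 1 - sqrtm3 R by rewrite zE; field.
rewrite /= -[sin _]/(complex.Im z) => zz; exfalso.
by have := sqrtr_ge0 (3 : R); lra.
Qed.

Lemma expiBpi (R : realType) (t : R) : expi (t - pi) = - expi t.
Proof. by rewrite -[t in RHS](subrK pi) [in RHS]expiD expipi mulrN1 opprK. Qed.

(** * Orders and the main result *)

Lemma has_order_dvd (R : realType) (g : 'M[R[i]]_2) r n :
  has_order g r -> g ^+ n = 1 -> (r %| n)%N.
Proof. by case=> r0 gr rmin; apply: expr_order_dvd. Qed.

Lemma has_order_opp1 (R : realType) (g : 'M[R[i]]_2) r n :
  has_order g r -> g ^+ n = -1 -> (r %| 2 * n)%N && ~~ (r %| n)%N.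
Proof.
move=> gr gn; apply/andP; split.
  by apply: (has_order_dvd gr); rewrite mulnC exprM gn sqrrN expr1n.
apply/negP => /dvdnP[q nE]; move: gn; case: gr => _ gr _.
rewrite nE mulnC exprM gr expr1n => /matrixP/(_ 0 0)/eqP.
by rewrite !mxE /= -addr_eq0 -mulr2n pnatr_eq0.
Qed.

Theorem proposition22 (R : realType) (g : 'M[R[i]]_2) (r : nat) :
  GL2_eisenstein g ->
  has_order g r ->
  \det g = expi (- (2 * pi / 3)) ->
  [/\ \tr g \in [:: 0; (1 - sqrtm3 R) / 2; - ((1 - sqrtm3 R) / 2);
                    1 - sqrtm3 R; - (1 - sqrtm3 R)],
      r \in [:: 3; 6; 12]%N &
  [/\ (\tr g = 0 <-> eigenvalues g (expi (pi / 6)) (expi (- (5 * pi / 6)))) /\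
      (\tr g = 0 <-> r = 12%N),
      (\tr g = (1 - sqrtm3 R) / 2 <-> eigenvalues g (expi (4 * pi / 3)) 1) /\
      (\tr g = (1 - sqrtm3 R) / 2 -> r = 3%N),
      (\tr g = -1 + sqrtm3 R <-> g = (expi (2 * pi / 3))%:M) /\
      (\tr g = -1 + sqrtm3 R -> r = 3%N),
      (\tr g = (-1 + sqrtm3 R) / 2 <-> eigenvalues g (expi (pi / 3)) (-1)) /\
      (\tr g = (-1 + sqrtm3 R) / 2 -> r = 6%N) &
      (\tr g = 1 - sqrtm3 R <-> g = (expi (- (pi / 3)))%:M) /\
      (\tr g = 1 - sqrtm3 R -> r = 6%N)]].
Proof.
move=> [gE _] gr.
pose w : R[i] := expi (pi / 3).
(* Every angle is brought back to pi/3 and pi/6, up to half turns. *)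
have -> : 4 * pi / 3 = pi / 3 + pi :> R by field.
have -> : - (2 * pi / 3) = pi / 3 - pi :> R by field.
have -> : - (pi / 3) = pi / 3 + pi / 3 - pi :> R by field.
have -> : 2 * pi / 3 = pi / 3 + pi / 3 :> R by field.
have -> : - (5 * pi / 6) = pi / 6 - pi :> R by field.
rewrite !expiBpi (expiD (pi / 3) pi) (expiD (pi / 3) (pi / 3)) expipi.
rewrite -!/w.
have zE : expi (pi / 6) ^+ 2 = w.
  by rewrite expr2 -expiD /w; congr expi; field.
have sE : sqrtm3 R = 2 * w - 1 by rewrite /w expi_pi3; field.
have w2 : w ^+ 2 = w - 1.
  have -> : w = (1 + sqrtm3 R) / 2 by rewrite sE; field.
  by rewrite expr_div_n sqrrD sqr_sqrtm3; field.
have -> : (1 - sqrtm3 R) / 2 = 1 - w by rewrite sE; field.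
have -> : (-1 + sqrtm3 R) / 2 = - (1 - w) by rewrite sE; field.
have -> : -1 + sqrtm3 R = - (2 * (1 - w)) by rewrite sE; ring.
have -> : 1 - sqrtm3 R = 2 * (1 - w) by rewrite sE; ring.
rewrite -expr2 w2 mulrN1 -[w - 1]opprB opprK => detg.
have [r0 gr1 rmin] := gr.
have [s tE s5] : exists2 s : int,
    \tr g = s%:~R * (1 - w) & s \in [:: -2; -1; 0; 1; 2].
  have [a [b gE0]] := gE 0 0; have [c [d gE1]] := gE 1 1.
  apply: (@mxtrace_sixth_root_multiple _ w g _ (a + c) (b + d) w2 detg r0 gr1).
  rewrite -expi_pi3 -/w in gE0 gE1.
  rewrite /mxtrace !big_ord_recl big_ord0 /= addr0.
  by rewrite (_ : lift _ _ = 1) ?gE0 ?gE1 ?intrD; [ring | apply: val_inj].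
have w1n0 : 1 - w != 0.
  apply/eqP => w10; move/eqP: w2; rewrite -[w](subrK 1) -opprB w10.
  by rewrite oppr0 add0r subrr expr1n oner_eq0.
have trsE (u : int) : (\tr g = u%:~R * (1 - w)) <-> s = u.
  rewrite tE; split => [/(mulIf w1n0)/eqP|->//].
  by rewrite eqr_int => /eqP.
have tr0 : \tr g = 0 <-> s = 0 by rewrite -trsE mul0r.
have tr1 : \tr g = 1 - w <-> s = 1 by rewrite -trsE mul1r.
have trN1 : \tr g = - (1 - w) <-> s = -1 by rewrite -trsE mulN1r.
have tr2 : \tr g = 2 * (1 - w) <-> s = 2 by rewrite -trsE.
have trN2 : \tr g = - (2 * (1 - w)) <-> s = -2 by rewrite -trsE -mulNr.
have g3 := sixth_root_mx_cube w2 detg tE.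
have dvd3 := order_dvd3 w2 detg gr1.
have r3 : g ^+ 3 = 1 -> r = 3%N.
  by move=> /(has_order_dvd gr) r3; apply/eqP; rewrite eqn_dvd r3.
have r6 : g ^+ 3 = -1 -> r = 6%N.
  move=> /(has_order_opp1 gr)/andP[]; rewrite dvdn_divisors // !inE.
  by case/or4P => /eqP rE; rewrite rE in dvd3 *.
have r12 : g ^+ 6 = -1 -> r = 12%N.
  move=> /(has_order_opp1 gr)/andP[]; rewrite dvdn_divisors // !inE.
  by case/or4P => [/eqP rE|/eqP rE|/eqP rE|/or3P[]/eqP rE];
    rewrite rE in dvd3 *.
have rs0 : s = 0 -> r = 12%N.
  move=> s0; apply: r12; rewrite (exprM g 2 3) mx2_sqr tE s0.
  rewrite mul0r scale0r add0r detg.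
  rewrite -[(- w)%:M]scalemx1 -scaleNr opprK exprZn expr1n.
  by rewrite (sixth_root_cube w2) scaleN1r.
have rs1 : s = 1 -> r = 3%N.
  by move=> s1; apply: r3; rewrite g3 s1 expr1n subrr mul0r scale0r add0r.
have rsN1 : s = -1 -> r = 6%N.
  move=> s1; apply: r6; rewrite g3 s1 sqrrN expr1n subrr mul0r scale0r add0r.
  by rewrite -[LHS]scalemx1 scaleN1r.
have scalar2 : s = 2 -> g = (1 - w)%:M.
  move/tr2 => t2; rewrite -[1 - w]mul1r.
  exact: sixth_root_mx_scalar w2 detg r0 gr1 (mem_head _ _) t2.
have scalarN2 : s = -2 -> g = (- (1 - w))%:M.
  move=> s2; rewrite -mulN1r.
  by apply: (sixth_root_mx_scalar w2 detg r0 gr1 (s := -1)) => //;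
    rewrite tE s2.
have w13 := sixth_root_conj_cube w2.
have rs2 : s = 2 -> r = 6%N.
  move/scalar2 => gS; apply: r6; rewrite gS -scalemx1 exprZn expr1n w13.
  by rewrite scaleN1r.
have rsN2 : s = -2 -> r = 3%N.
  move/scalarN2 => gS; apply: r3; rewrite gS -scalemx1 exprZn expr1n.
  by rewrite exprNn w13 -exprSr -signr_odd scale1r.
have eigE a b t : a * b = - w -> a + b = t -> \tr g = t <-> eigenvalues g a b.
  by move=> ab <-; apply: char_poly2_splitE; rewrite detg ab.
split.
- by move: s5; rewrite tE !inE => /or4P[/eqP->|/eqP->|/eqP->|/orP[]/eqP->];
    rewrite ?mulN1r ?mul0r ?mul1r ?mulNr ?eqxx ?orbT.
- move: s5; rewrite !inE => /or4P[/eqP/rsN2->|/eqP/rsN1->|/eqP/rs0->|] //.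
  by case/orP=> [/eqP/rs1->|/eqP/rs2->].
split.
- split; first by apply: eigE; rewrite ?mulrN -?expr2 ?zE ?subrr.
  split=> [/tr0 //|r12']; apply/tr0; move: s5; rewrite !inE.
  by case/or4P => [/eqP/rsN2|/eqP/rsN1|/eqP|/orP[/eqP/rs1|/eqP/rs2]] //;
    rewrite r12'.
- by split; [apply: eigE; rewrite ?mulr1 // addrC | move/tr1].
- split; last by move/trN2.
  split=> [/trN2 //|->]; by rewrite mxtrace_scalar mulNrn mulr_natl.
- split; last by move/trN1.
  by apply: eigE; [rewrite mulrN1 | rewrite opprB].
- split; last by move/tr2.
  split=> [/tr2 //|->]; by rewrite mxtrace_scalar mulr_natl.
Qed.
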